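(* Let $G$ be a finite simple undirected graph with $n$ vertices and at least one edge, and let $\mu_2$ and $\mu_n$ denote the second smallest and the largest eigenvalue of the Laplacian matrix of $G$, respectively. Then $$\alpha'(G) \ge \min\left\{\left\lceil \frac{\mu_2}{\mu_n}(n-1)\right\rceil,\ \left\lceil \frac{1}{2}(n-1)\right\rceil\right\}.$$
   Context: The Laplacian matrix of a graph $G$ is $L = D - A$, where $D$ is the diagonal matrix of vertex degrees and $A$ is the adjacency matrix. The eigenvalues of $L$ are listed with multiplicity in nondecreasing order $0=\mu_1 \le \mu_2 \le \cdots \le \mu_n$. A matching is a set of pairwise non-adjacent edges, and the matching number $\alpha'(G)$ is the maximum size of a matching in $G$. *)

(* Defs.v *)
From mathcomp Require Import all_boot all_order all_algebra.
From mathcomp Require Import complex.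
From mathcomp Require Import reals.

Set Implicit Arguments.
Unset Strict Implicit.
Unset Printing Implicit Defensive.

Import Order.TTheory GRing.Theory Num.Theory.
Local Open Scope ring_scope.

(* A finite simple graph is a symmetric irreflexive [e : rel T] on a finite
   type [T] of vertices. *)

Section Matching.
Variables (T : finType) (e : rel T).

Definition edges : {set {set T}} := [set [set p.1; p.2] | p : T * T & e p.1 p.2].

Definition is_matching (M : {set {set T}}) : bool :=
  (M \subset edges) && trivIset M.

Definition matching_number : nat := \max_(M : {set {set T}} | is_matching M) #|M|.

End Matching.

Section Laplacian.
Variables (R : realType) (T : finType) (e : rel T).

(* The vertices index rows and columns through the enumeration [enum_val] of
   [T]; the spectrum does not depend on it. *)
Definition adjacency_mx : 'M[R]_#|T| :=
  \matrix_(i, j) (e (enum_val i) (enum_val j))%:R.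

Definition degree (x : T) : nat := #|[set y | e x y]|.

Definition degree_mx : 'M[R]_#|T| :=
  diag_mx (\row_i (degree (enum_val i))%:R).

Definition laplacian : 'M[R]_#|T| := degree_mx - adjacency_mx.

End Laplacian.

(* [mu] lists the eigenvalues of [A], with multiplicity, in nondecreasing
   order; being 0-based, its entry [mu`_k] is the (k+1)-st smallest one. For a
   given [A] there is at most one such [mu], and when [A] is symmetric there is
   one: see [spectrum_uniq] and [spectrum_exists]. *)
Definition is_spectrum (R : realType) (n : nat) (A : 'M[R]_n) (mu : seq R) : Prop :=
  sorted <=%R mu /\ char_poly A = \prod_(x <- mu) ('X - x%:P).

Lemma spectrum_uniq (R : realType) (n : nat) (A : 'M[R]_n) (mu nu : seq R) :
  is_spectrum A mu -> is_spectrum A nu -> mu = nu.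
Proof.
move=> [smu Emu] [snu Enu]; apply: (sorted_eq le_trans le_anti smu snu).
by apply/permP => a; move: Emu; rewrite Enu => /prod_XsubC_eq/permP->.
Qed.

Lemma char_poly_conj (K : fieldType) (n : nat) (P D : 'M[K]_n) :
  P \in unitmx -> char_poly (invmx P *m D *m P) = char_poly D.
Proof.
move=> Pu; rewrite /char_poly.
have PC1 : map_mx polyC (invmx P) *m map_mx polyC P = 1%:M.
  by rewrite -map_mxM mulVmx // map_mx1.
have -> : char_poly_mx (invmx P *m D *m P)
    = map_mx polyC (invmx P) *m char_poly_mx D *m map_mx polyC P.
  rewrite /char_poly_mx !map_mxM mulmxBr mulmxBl; congr (_ - _).
  by rewrite -mulmxA -scalar_mxC mulmxA PC1 mul1mx.
by rewrite !det_mulmx mulrAC -det_mulmx PC1 det1 mul1r.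
Qed.

Lemma spectrum_exists (R : realType) (n : nat) (A : 'M[R]_n) :
  A^T = A -> exists mu : seq R, is_spectrum A mu.
Proof.
move=> Asym; pose toC := real_complex R; pose B := map_mx toC A.
have Bh : B \is hermsymmx.
  apply/is_hermitianmxP; rewrite expr0 scale1r.
  apply/matrixP => i j; rewrite !mxE -[in RHS]Asym !mxE.
  by apply/esym/CrealP/complex_realP; exists (A i j).
have /orthomx_spectralP EB := hermitian_normalmx Bh.
have /mxOverP Dr := hermitian_spectral_diag_real Bh.
pose mu := [seq complex.Re (spectral_diag B 0 i) | i <- enum 'I_n].
exists (sort <=%R mu); split; first exact: sort_le_sorted.
rewrite (perm_big mu) ?perm_sort //=; apply: (map_poly_inj toC).
rewrite map_char_poly -/B EB char_poly_conj ?spectral_unit //.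
rewrite char_poly_trig ?diag_mx_is_trig // big_map big_enum rmorph_prod /=.
apply: eq_bigr => i _.
by rewrite rmorphB /= map_polyX map_polyC /= mxE eqxx mulr1n RRe_real.
Qed.

Lemma laplacian_sym (R : realType) (T : finType) (e : rel T) :
  symmetric e -> (laplacian R e)^T = laplacian R e.
Proof.
move=> es; apply/matrixP => i j; rewrite !mxE es eq_sym.
by case: eqVneq => [->|].
Qed.

(* Main.v *)
Require Import Defs.
From mathcomp Require Import all_boot all_order all_algebra.
From mathcomp Require Import reals.
From mathcomp Require Import perm complex.
From mathcomp Require Import zify ring lra.

(** Let [n] be the number of vertices and [alpha] the matching number.

    Combinatorial half. By the Tutte-Berge formula there is a set [S] of [s]
    vertices such that [G - S] has at least [c] components, where
    [2 alpha >= n + s - c]; this is [matching_barrier]. It is proved by making [S]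
    as large as possible among the sets whose deletion lowers the matching
    number by [s], and then using Gallai's argument
    ([never_both_missed_trans]): in [G - S] a maximum matching misses at most
    one vertex of each component. If [c <= s + 1] then [2 alpha >= n - 1] and the
    second term of the minimum is reached.

    Spectral half. Suppose [c >= s + 2], and split the components of [G - S]
    into two groups [X] and [Y], as evenly as possible in the number of components
    ([balanced_separation]). The signs +1 on [X], -1 on [Y] and their absolute
    value define two functions with the same Laplacian energy, because no edge
    joins [X] to [Y]. The variational bounds [rayleigh_ge_second] and
    [rayleigh_le_max], applied to the first and to the second after subtracting
    means, give ([separation_inequality])
    [mu_2 * (s N + 4 x y) <= mu_n * s N], with [x = #|X|], [y = #|Y|], [N = x + y].

    Since each group contains at least half of [c] components, rounded down,
    [x] and [y] cannot be too unbalanced, so that this inequality yields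
    [2 (mu_2 / mu_n) (n - 1) <= n + s - c <= 2 alpha]
    ([matching_bound_of_ratio]). *)

Set Implicit Arguments.
Unset Strict Implicit.
Unset Printing Implicit Defensive.

Import Order.TTheory GRing.Theory Num.Theory.

(** * Maximum matchings and barriers *)

Section Matchings.
Variables (T : finType) (e : rel T).
Hypotheses (esym : symmetric e) (eirr : irreflexive e).
Implicit Types (W S : {set T}) (f g : {ffun T -> T}) (u v t x y z w : T).

(** A matching inside [W] is encoded as the involution exchanging the ends of
    each edge and fixing the uncovered vertices, so that replacing an edge by
    an adjacent one only redefines a function at a few points. *)
Definition matching_in W f : bool :=
  [forall x, (f (f x) == x) && ((f x != x) ==> (x \in W) && e x (f x))].

Definition covered f : {set T} := [set x | f x != x].

Lemma matching_inP W f :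
  reflect (involutive f /\ forall x, f x != x -> x \in W /\ e x (f x))
          (matching_in W f).
Proof.
apply: (iffP forallP) => [fM | [fI fW] x].
  split=> [x | x fx]; first by case/andP: (fM x) => /eqP.
  by case/andP: (fM x) => _ /implyP/(_ fx)/andP.
by rewrite fI eqxx /=; apply/implyP => /fW[-> ->].
Qed.

Lemma matching_in_sub W S f : W \subset S -> matching_in W f -> matching_in S f.
Proof.
move=> WS /matching_inP[fI fW]; apply/matching_inP; split=> // x /fW[xW exy].
by rewrite (subsetP WS).
Qed.

Definition matching_edges f : {set {set T}} := [set [set x; f x] | x in covered f].

Lemma matching_edges_partition W f :
  matching_in W f -> partition (matching_edges f) (covered f).
Proof.
case/matching_inP=> fI _.
have blockE x y : y \in [set x; f x] -> [set x; f x] = [set y; f y].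
  by case/set2P=> ->; rewrite ?fI // setUC.
apply/and3P; split.
- apply/eqP/setP=> x; apply/bigcupP/idP => [[_ /imsetP[y yf ->]] | xf].
    by case/set2P=> -> //; rewrite inE fI eq_sym; move: yf; rewrite inE.
  by exists [set x; f x]; [exact: imset_f | exact: set21].
- apply/trivIsetP=> _ _ /imsetP[x _ ->] /imsetP[y _ ->].
  apply: contraR => /pred0Pn[z /andP[/= zx zy]].
  by rewrite (blockE _ _ zx) (blockE _ _ zy).
- by apply/imsetP=> -[x _ /setP/(_ x)]; rewrite !inE eqxx.
Qed.

(** The edges of a matching partition the covered vertices into pairs. *)
Lemma card_covered W f :
  matching_in W f -> #|covered f| = #|matching_edges f|.*2.
Proof.
move=> fM; rewrite -muln2.
apply: (card_uniform_partition _ (matching_edges_partition fM)) => _ /imsetP[x xf ->].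
by rewrite cards2 eq_sym; move: xf; rewrite inE => ->.
Qed.

Lemma covered_le_matching_number W f :
  matching_in W f -> #|covered f| <= (matching_number e).*2.
Proof.
move=> fM; rewrite (card_covered fM) leq_double.
have /and3P[_ trivM _] := matching_edges_partition fM.
apply: (leq_bigmax_cond (F := fun M : {set {set T}} => #|M|)).
rewrite /is_matching trivM andbT.
apply/subsetP=> _ /imsetP[x xf ->].
have /matching_inP[_ /(_ x)] := fM; move: xf; rewrite inE => xf /(_ xf)[_ exy].
by apply/imsetP; exists (x, f x); rewrite ?inE.
Qed.

Definition max_covered W : nat := \max_(f | matching_in W f) #|covered f|.

Definition maximum_in W f : bool := matching_in W f && (#|covered f| == max_covered W).

Lemma covered_le_max W f : matching_in W f -> #|covered f| <= max_covered W.
Proof. exact: (leq_bigmax_cond (F := fun f => #|covered f|)). Qed.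

Lemma maximum_in_exists W : exists f, maximum_in W f.
Proof.
have idM : matching_in W [ffun x => x].
  by apply/matching_inP; split=> [x | x]; rewrite !ffunE ?eqxx.
have [|f fM fE] :=
  @eq_bigmax_cond _ (matching_in W) (fun f : {ffun T -> T} => #|covered f|).
  by apply/card_gt0P; exists [ffun x => x].
by exists f; apply/andP; split; [exact: fM | apply/eqP; rewrite -fE].
Qed.

(** For an uncovered [x], this adds the edge [xy], and drops the edge of [f] at
    [y] if there is one. Both ways of improving a matching are instances:
    augmentation when [y] is uncovered, and rotation, which keeps the size,
    when it is not. *)
Definition rematch f x y : {ffun T -> T} :=
  [ffun w => if w == x then y else if w == y then x else
             if w == f y then w else f w].

Lemma rematch_matching W f x y :
    matching_in W f -> f x = x -> x \in W -> y \in W -> e x y ->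
  matching_in W (rematch f x y).
Proof.
case/matching_inP=> fI fW fx xW yW exy.
have xy : x != y by apply: contraTneq exy => ->; rewrite eirr.
apply/matching_inP; split=> w; rewrite !ffunE; last first.
  have [->//|_] := eqVneq w x.
  have [->|_] := eqVneq w y; first by rewrite esym.
  by have [->|_] := eqVneq w (f y); [rewrite eqxx | exact: fW].
have [->|wx] := eqVneq w x; first by rewrite eq_sym (negPf xy) eqxx.
have [->|wy] := eqVneq w y; first by rewrite eqxx.
have [wE|wfy] := eqVneq w (f y).
  by rewrite (negPf wx) (negPf wy) -wE eqxx.
have [fwx|_] := eqVneq (f w) x; first by case/eqP: wx; rewrite -(fI w) fwx.
have [fwy|_] := eqVneq (f w) y; first by case/eqP: wfy; rewrite -fwy fI.
have [fwy|_] := eqVneq (f w) (f y); last exact: fI.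
by case/eqP: wy; apply: (can_inj fI).
Qed.

Lemma covered_rematch_free f x y :
  f x = x -> f y = y -> x != y -> covered (rematch f x y) = x |: (y |: covered f).
Proof.
move=> fx fy xy; apply/setP=> w; rewrite !inE ffunE fy.
have [->|_] := eqVneq w x; first by rewrite eq_sym xy.
by have [->|_] := eqVneq w y; first by rewrite xy.
Qed.

Lemma covered_rematch W f x y : matching_in W f ->
  f x = x -> f y != y -> x != y -> covered (rematch f x y) = x |: covered f :\ f y.
Proof.
case/matching_inP=> fI _ fx fy xy; apply/setP=> w; rewrite !inE ffunE.
have [->|_] := eqVneq w x; first by rewrite eq_sym xy.
have [->|_] := eqVneq w y; first by rewrite xy eq_sym fy.
by have [->|_] := eqVneq w (f y); first by rewrite eqxx.
Qed.

(** Otherwise [rematch] would augment [f]. *)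
Lemma maximum_no_free_edge W f x y :
  maximum_in W f -> x \in W -> y \in W -> e x y -> f x = x -> f y != y.
Proof.
case/andP=> fM /eqP fE xW yW exy fx; apply/eqP=> fy.
have xy : x != y by apply: contraTneq exy => ->; rewrite eirr.
have := covered_le_max (rematch_matching fM fx xW yW exy).
rewrite covered_rematch_free // !cardsU1 !inE fx fy !eqxx (negPf xy) /= -fE.
lia.
Qed.

Lemma maximum_rematch W f x y :
    maximum_in W f -> x \in W -> y \in W -> e x y -> f x = x ->
  maximum_in W (rematch f x y).
Proof.
move=> fMax xW yW exy fx; have fy := maximum_no_free_edge fMax xW yW exy fx.
have xy : x != y by apply: contraTneq exy => ->; rewrite eirr.
case/andP: fMax => fM /eqP fE; have /matching_inP[fI _] := fM.
rewrite /maximum_in rematch_matching //= (covered_rematch fM) // cardsU1 -fE.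
have fyc : f y \in covered f by rewrite inE fI eq_sym.
by rewrite (cardsD1 (f y) (covered f)) fyc !inE fx eqxx andbF.
Qed.

Definition agree f g : {set T} := [set w | (f w == g w) && (g w != w)].

(** Rotating [f] onto the edge of [g] at [x] discards an edge of [f] that [g]
    does not contain, since the edge of [g] at [g x] is the one at [x]. *)
Lemma agree_rematch W f g x : matching_in W f -> matching_in W g ->
    f x = x -> g x != x -> #|agree f g| < #|agree (rematch f x (g x)) g|.
Proof.
case/matching_inP=> fI _ /matching_inP[gI _] fx gx.
apply: proper_card; apply/properP; split; last first.
  by exists x; rewrite !inE ?ffunE ?eqxx //= fx eq_sym (negPf gx).
apply/subsetP=> w; rewrite !inE ffunE => /andP[/eqP fw gw]; rewrite gw andbT.
have [->//|wx] := eqVneq w x.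
have [->|wgx] := eqVneq w (g x); first by rewrite gI.
have [wfgx|_] := eqVneq w (f (g x)); last exact/eqP.
by case/eqP: wx; apply: (can_inj gI); rewrite -fw wfgx fI.
Qed.

Definition never_both_missed W u v :=
  forall f, maximum_in W f -> f u = u -> f v <> v.

(** The heart of Gallai's lemma. If a maximum matching [g] missed both [u] and
    [v], take a maximum matching [f] that misses [t] and agrees with [g] as much
    as possible. It covers [u] and [v], which [g] misses, so as both have the
    same size [g] covers at least two vertices missed by [f], one of them
    [x != t]. Rotating [f] onto the edge of [g] at [x] increases the agreement
    while still missing [t]. *)
Lemma never_both_missed_trans W u t v : u != v ->
    (exists2 f, maximum_in W f & f t = t) ->
  never_both_missed W u t -> never_both_missed W t v -> never_both_missed W u v.
Proof.
move=> uv [f0 f0Max f0t] ut tv g gMax gu gv.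
have f0P : [pred f | maximum_in W f & f t == t] f0 by rewrite /= f0Max f0t eqxx.
case: (@arg_maxnP _ f0 _ (fun f => #|agree f g|) f0P) => f /andP[fMax /eqP ft] fOpt.
have fu : f u != u by apply/eqP => /(ut f fMax)/(_ ft).
have fv : f v != v by apply/eqP; exact: (tv f fMax ft).
have gt : g t != t by apply/eqP; exact: (ut g gMax gu).
have /andP[fM /eqP fE] := fMax; have /andP[gM /eqP gE] := gMax.
have [x xt /andP[gx fx]] : exists2 x, x != t & (g x != x) && (f x == x).
  have card_diff : #|covered g :\: covered f| = #|covered f :\: covered g|.
    by rewrite !cardsD fE gE setIC.
  have : 1 < #|covered g :\: covered f|.
    rewrite card_diff; apply: leq_trans (_ : #|[set u; v]| <= _).
      by rewrite cards2 uv.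
    by apply/subset_leq_card/subsetP => w /set2P[] ->; rewrite !inE ?gu ?gv eqxx.
  rewrite (cardsD1 t) !inE ft eqxx gt /= ltnS => /card_gt0P[x].
  by rewrite !inE negbK => /and3P[xt fx gx]; exists x; rewrite // gx fx.
move/eqP: fx => fx; have /matching_inP[gI gW] := gM.
have [xW exy] := gW _ gx.
have [yW _] : g x \in W /\ e (g x) (g (g x)) by apply: gW; rewrite gI eq_sym.
have f'Max := maximum_rematch fMax xW yW exy fx.
have fgx := maximum_no_free_edge fMax xW yW exy fx.
have f't : rematch f x (g x) t == t.
  have tgx : (t == g x) = false by apply: contraNF fgx => /eqP <-; rewrite ft.
  by rewrite ffunE [t == x]eq_sym (negPf xt) tgx ft; case: (t == f _).
have := agree_rematch fM gM fx gx; rewrite ltnNge => /negP; apply.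
by apply: (fOpt (rematch f x (g x))); rewrite /= f'Max f't.
Qed.

Definition avoiding S : rel T := [rel x y | [&& x \notin S, y \notin S & e x y]].

(** The ends of an edge are never both missed, and transitivity carries this
    along paths. *)
Lemma connected_never_both_missed S u v :
    (forall t, t \notin S -> exists2 f, maximum_in (~: S) f & f t = t) ->
  u != v -> connect (avoiding S) u v -> never_both_missed (~: S) u v.
Proof.
move=> missable uv /connectP[p]; elim: p u uv => [|w p IHp] u uv /=.
  by move=> _ vu; rewrite vu eqxx in uv.
case/andP=> /and3P[uS wS euw] wp vE.
have uw : never_both_missed (~: S) u w.
  move=> f fMax fu; apply/eqP.
  by apply: (maximum_no_free_edge fMax _ _ euw fu); rewrite inE.
have [wv|wv] := eqVneq w v; first by rewrite -wv.
by apply: (never_both_missed_trans uv (missable w wS) uw); exact: IHp.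
Qed.

(** The hard half of the Tutte-Berge formula, with the components of [G - S]
    given by representatives [U]. Take [S] as large as possible such that
    deleting it lowers twice the matching number by at least [2 #|S|]. Then every
    vertex of [G - S] is missed by some maximum matching of [G - S]: a vertex
    always covered could be added to [S]. Hence the vertices [U] missed by one
    fixed maximum matching of [G - S] lie in distinct components. *)
Lemma matching_barrier : exists S U : {set T},
  [/\ [disjoint S & U],
      #|T| + #|S| <= (matching_number e).*2 + #|U| &
      {in U &, forall u v, connect (avoiding S) u v -> u = v}].
Proof.
pose good S := max_covered (~: S) + #|S|.*2 <= max_covered setT.
have good0 : good set0 by rewrite /good cards0 addn0 setC0.
case: (@arg_maxnP _ set0 good (fun S : {set T} => #|S|) good0) => S Sgood Smax.
have missable t : t \notin S -> exists2 f, maximum_in (~: S) f & f t = t.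
  move=> tS.
  have [/existsP[f /andP[fM /eqP ft]] | nof] :=
    boolP [exists f, maximum_in (~: S) f && (f t == t)]; first by exists f.
  have [f /andP[fM /eqP fE]] := maximum_in_exists (~: (t |: S)).
  have fMS : matching_in (~: S) f.
    by apply: matching_in_sub fM; rewrite setCS subsetUr.
  have ft : f t == t.
    have /matching_inP[_ /(_ t)] := fM; case: eqVneq => // _ /(_ isT)[].
    by rewrite !inE eqxx.
  (* Covered sets are even, so the strict inequality is worth 2. *)
  have lt_max : #|covered f| < max_covered (~: S).
    rewrite ltn_neqAle covered_le_max // andbT; apply: contra nof => fS.
    by apply/existsP; exists f; rewrite /maximum_in fMS fS.
  have [g /andP[gM /eqP gE]] := maximum_in_exists (~: S).
  have /Smax : good (t |: S).
    move: Sgood lt_max; rewrite /good cardsU1 tS -fE -gE.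
    rewrite (card_covered fMS) (card_covered gM); lia.
  by rewrite cardsU1 tS /=; lia.
have [f fMax] := maximum_in_exists (~: S).
exists S, (~: S :\: covered f); split.
- by rewrite disjoints_subset; apply/subsetP=> x xS; rewrite !inE xS andbF.
- have /andP[fM /eqP fE] := fMax.
  have [h /andP[hM /eqP hE]] := maximum_in_exists setT.
  have := covered_le_matching_number hM; rewrite hE.
  have fS : covered f \subset ~: S.
    by apply/subsetP=> x; rewrite inE; have /matching_inP[_ fW] := fM => /fW[].
  have := subset_leq_card fS; have := cardsC S.
  by rewrite cardsD (setIidPr fS) fE; move: Sgood; rewrite /good; lia.
- move=> u v; rewrite !inE !negbK => /andP[/eqP fu _] /andP[/eqP fv _] uv.
  apply/eqP; apply: contraT => neq.
  by case: (connected_never_both_missed missable neq uv fMax fu).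
Qed.

(** [X] gathers the components of [G - S] that contain one half of the
    representatives [U], and [Y] is all the rest of [G - S]. *)
Lemma balanced_separation : exists S U X Y : {set T},
  [/\ #|T| + #|S| <= (matching_number e).*2 + #|U|,
      #|U|./2 <= #|X| /\ uphalf #|U| <= #|Y|,
      #|T| = #|S| + #|X| + #|Y|, [disjoint X & Y] &
      forall x y, x \in X -> y \in Y -> ~~ e x y].
Proof.
have [S [U [SU leU sepU]]] := matching_barrier.
have [A AU cardA] : exists2 A : {set T}, A \subset U & #|A| = #|U|./2.
  have : exists A : {set T}, (A \subset U) && (#|A| == #|U|./2).
    have : 0 < #|[set A : {set T} | (A \subset U) && (#|A| == #|U|./2)]|.
      rewrite cards_draws bin_gt0; lia.
    by case/card_gt0P=> A; rewrite inE; exists A.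
  by case=> A /andP[? /eqP ?]; exists A.
pose X := [set x in ~: S | [exists a in A, connect (avoiding S) a x]].
have US : U \subset ~: S by rewrite -disjoints_subset disjoint_sym.
exists S, U, X, (~: S :\: X); split=> //.
- split.
    rewrite -cardA; apply/subset_leq_card/subsetP=> a aA.
    rewrite inE (subsetP US) ?(subsetP AU) //=.
    by apply/existsP; exists a; rewrite aA connect0.
  have -> : uphalf #|U| = #|U :\: A|.
    rewrite cardsD (setIidPr AU) cardA; lia.
  apply/subset_leq_card/subsetP=> u /setDP[uU uA].
  rewrite inE (subsetP US) // andbT inE (subsetP US) //=.
  apply/existsP=> -[a /andP[aA au]]; case/negP: uA.
  by rewrite -(sepU a u (subsetP AU a aA) uU au).
- have XS : X \subset ~: S by apply/subsetP=> x; rewrite inE => /andP[].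
  have := subset_leq_card XS; rewrite cardsD (setIidPr XS).
  have := cardsC S; lia.
- by rewrite disjoint_sym disjoints_subset; apply/subsetP=> x; rewrite !inE => /andP[].
- move=> x y; rewrite !inE => /andP[xS /existsP[a /andP[aA ax]]] /andP[yX yS].
  apply: contra yX => exy; rewrite yS /=; apply/existsP; exists a; rewrite aA /=.
  by apply: connect_trans ax (connect1 _); exact/and3P.
Qed.

End Matchings.

Local Open Scope ring_scope.

(** * Rayleigh quotients of a real symmetric matrix *)

Section Rayleigh.
Local Open Scope sesquilinear_scope.
Variables (R : realType) (n : nat) (A : 'M[R]_n) (mu : seq R).
Hypotheses (Asym : A^T = A) (spec_mu : is_spectrum A mu).

Local Notation toC := (real_complex R).

Lemma size_spectrum : size mu = n.
Proof.
case: spec_mu => _ /(congr1 (fun p : {poly R} => size p)).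
by rewrite size_char_poly size_prod_XsubC => -[].
Qed.

(** The permutation [s] is needed because the unitary diagonalization lists the
    eigenvalues in an order of its own, whereas [mu] is sorted. *)
Lemma spectral_decomposition : exists (P : 'M[R[i]]_n) (s : 'S_n),
  P \is unitarymx /\
  map_mx toC A = P^t* *m diag_mx (\row_i toC mu`_(s i)) *m P.
Proof.
pose B := map_mx toC A.
have BC : B^t* = B.
  apply/matrixP => i j; rewrite !mxE -[in RHS]Asym mxE.
  by apply/CrealP/complex_realP; exists (A j i).
have /orthomx_spectralP EB : B \is normalmx by apply/normalmxP; rewrite BC.
have Pu := spectral_unitarymx B.
pose d := [tuple spectral_diag B 0 i | i < n].
pose m := [tuple toC mu`_i | i < n].
have dm : perm_eq d m.
  apply/prod_XsubC_eq.
  have <- : char_poly B = \prod_(x <- d) ('X - x%:P).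
    rewrite EB char_poly_conj ?spectral_unit // char_poly_trig ?diag_mx_is_trig //.
    rewrite big_map big_enum /=.
    by apply: eq_bigr => i _; rewrite mxE eqxx mulr1n.
  have [_ Emu] := spec_mu; rewrite -map_char_poly Emu rmorph_prod /=.
  rewrite (big_nth 0) big_mkord size_spectrum big_map big_enum /=.
  by apply: eq_bigr => i _; rewrite rmorphB /= map_polyX map_polyC.
have /tuple_permP[s dE] := dm.
exists (spectralmx B), s; split=> //.
rewrite -/B -invmx_unitary //; apply: etrans EB _; congr (_ *m diag_mx _ *m _).
apply/rowP => i; rewrite !mxE.
have -> : spectral_diag B 0 i = tnth d i by rewrite tnth_mktuple.
rewrite (tnth_nth 0) dE -tnth_nth.
by rewrite !tnth_mktuple.
Qed.

(** [F u] is the coordinate row of [u] in an orthonormal eigenbasis. The basis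
    is complex although [A] is real, which is harmless since only
    Hermitian products of coordinate rows matter. *)
Lemma spectral_coordinates : exists (F : 'rV[R]_n -> 'rV[R[i]]_n) (s : 'S_n),
  [/\ forall u v, toC ((u *m v^T) 0 0) = \sum_i F u 0 i * (F v 0 i)^*,
      forall u v, toC ((u *m A *m v^T) 0 0)
        = \sum_i toC mu`_(s i) * (F u 0 i * (F v 0 i)^*) &
      forall u i, F (u *m A) 0 i = toC mu`_(s i) * F u 0 i].
Proof.
have [P [s [Pu AE]]] := spectral_decomposition.
pose F (u : 'rV[R]_n) := map_mx toC u *m P^t*; exists F, s.
have realC (v : 'rV[R]_n) : (map_mx toC v)^t* = (map_mx toC v)^T.
  apply/matrixP => i j; rewrite !mxE.
  by apply/CrealP/complex_realP; exists (v j i).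
have FA u i : F (u *m A) 0 i = toC mu`_(s i) * F u 0 i.
  rewrite /F map_mxM AE !mulmxA mulmxtVK // mul_mx_diag !mxE.
  by rewrite mulrC.
have Fdot u v : toC ((u *m v^T) 0 0) = \sum_i F u 0 i * (F v 0 i)^*.
  have -> : toC ((u *m v^T) 0 0) = (F u *m (F v)^t*) 0 0.
    rewrite /F trmx_mul map_mxM -/(P^t* ^t*) trmxCK mulmxA mulmxKtV //.
    by rewrite realC map_trmx -map_mxM [RHS]mxE.
  by rewrite mxE; apply: eq_bigr => i _; rewrite !mxE.
split=> // u v; rewrite Fdot; apply: eq_bigr => i _.
by rewrite FA mulrA.
Qed.

Lemma rayleigh_le_max (u : 'rV[R]_n) :
  (u *m A *m u^T) 0 0 <= mu`_n.-1 * (u *m u^T) 0 0.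
Proof.
have [F [s [Fdot FA _]]] := spectral_coordinates.
rewrite -lecR [X in _ <= X]rmorphM /= FA Fdot mulr_sumr.
apply: ler_sum => i _; rewrite ler_wpM2r ?mul_conjC_ge0 // lecR.
have [smu _] := spec_mu.
have n_gt0 : (0 < n)%N by apply: leq_ltn_trans (ltn_ord i).
apply: (sorted_leq_nth le_trans lexx) => //; rewrite ?inE ?size_spectrum ?prednK //.
by rewrite -ltnS prednK.
Qed.

(** As all eigenvalues but the one of index 0 are positive, a kernel vector [z]
    is concentrated on a single eigenvector. A vector orthogonal to [z] has no
    coordinate there, and only meets eigenvalues at least [mu`_1]. *)
Lemma rayleigh_ge_second (z u : 'rV[R]_n) : z != 0 -> z *m A = 0 -> 0 < mu`_1 ->
  (u *m z^T) 0 0 = 0 -> mu`_1 * (u *m u^T) 0 0 <= (u *m A *m u^T) 0 0.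
Proof.
move=> z0 zA mu1 uz.
have [F [s [Fdot FA FAl]]] := spectral_coordinates.
have [smu _] := spec_mu.
have mu_ge i : s i != 0%N :> nat -> mu`_1 <= mu`_(s i).
  rewrite -lt0n => si; have n_gt1 : (1 < n)%N by apply: leq_ltn_trans (ltn_ord (s i)).
  by apply: (sorted_leq_nth le_trans lexx) => //; rewrite ?inE ?size_spectrum.
have Fz i : s i != 0%N :> nat -> F z 0 i = 0.
  move=> /mu_ge si; have := FAl z i; rewrite zA.
  have -> : F 0 0 i = 0.
    have := Fdot 0 0; rewrite mul0mx mxE rmorph0 => /esym/psumr_eq0P F0.
    by apply/eqP; rewrite -mul_conjC_eq0 F0 // => j _; rewrite mul_conjC_ge0.
  move/esym/eqP; rewrite mulf_eq0 => /orP[|/eqP//].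
  by rewrite (inj_eq (fmorph_inj _)) => /eqP mu0; rewrite mu0 leNgt mu1 in si.
have Fu i : s i = 0%N :> nat -> F u 0 i = 0.
  move=> si.
  have onlyi j : j != i -> F z 0 j = 0.
    move=> ji; apply: Fz; apply: contra ji => /eqP sj.
    by apply/eqP/(@perm_inj _ s)/val_inj; rewrite /= sj si.
  have Fzi : F z 0 i != 0.
    apply: contraNneq z0 => zi.
    have : toC ((z *m z^T) 0 0) = 0.
      rewrite Fdot big1 // => j _; have [->|/onlyi->] := eqVneq j i.
        by rewrite zi mul0r.
      by rewrite mul0r.
    move/eqP; rewrite (inj_eq (fmorph_inj _)) mxE => /eqP zz0.
    apply/eqP/rowP => j; apply/eqP; rewrite !mxE -sqrf_eq0.
    have {}zz0 : \sum_k z 0 k ^+ 2 = 0.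
      by rewrite -[RHS]zz0; apply: eq_bigr => k _; rewrite mxE -expr2.
    by move/psumr_eq0P: zz0 => -> // k _; exact: sqr_ge0.
  have := Fdot u z; rewrite uz rmorph0 (bigD1 i) //= big1 => [|j /onlyi->].
    move/esym/eqP; rewrite addr0 mulf_eq0 conjC_eq0 (negPf Fzi) orbF.
    by move/eqP.
  by rewrite conjC0 mulr0.
rewrite -lecR [X in X <= _]rmorphM /= FA Fdot mulr_sumr.
apply: ler_sum => i _.
have [/Fu->|/mu_ge si] := eqVneq (s i : nat) 0%N; first by rewrite mul0r !mulr0.
by rewrite ler_wpM2r ?mul_conjC_ge0 // lecR.
Qed.

End Rayleigh.

(** * The Laplacian form and separated vertex sets *)

Section LaplacianForm.
Variables (R : realType) (T : finType) (e : rel T).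
Hypothesis esym : symmetric e.
Implicit Types h k : T -> R.

Definition vertex_row h : 'rV[R]_#|T| := \row_i h (enum_val i).

Lemma sum_enum_val h : \sum_(i < #|T|) h (enum_val i) = \sum_x h x.
Proof.
by rewrite [RHS](reindex (@enum_val T T)) //; apply/onW_bij/enum_val_bij.
Qed.

Lemma vertex_row_dot h k : (vertex_row h *m (vertex_row k)^T) 0 0 = \sum_x h x * k x.
Proof.
rewrite mxE -(sum_enum_val (fun x => h x * k x)).
by apply: eq_bigr => i _; rewrite !mxE.
Qed.

Lemma laplacian_apply h y :
  (vertex_row h *m laplacian R e) 0 (enum_rank y)
    = \sum_x (e x y)%:R * (h y - h x).
Proof.
rewrite mulmxBr mxE [X in _ + X]mxE mul_mx_diag !mxE enum_rankK.
rewrite (eq_bigr (fun x => (e x y)%:R * h y - (e x y)%:R * h x)); last first.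
  by move=> x _; rewrite mulrBr.
rewrite sumrB -mulr_suml; congr (_ - _).
  rewrite mulrC /degree -sum1_card natr_sum; congr (_ * _).
  rewrite big_mkcond /=; apply: eq_bigr => x _.
  by rewrite inE esym; case: (e x y).
rewrite -sum_enum_val; apply: eq_bigr => i _.
by rewrite !mxE enum_rankK mulrC.
Qed.

(** The sum runs over ordered pairs, hence counts every edge twice. *)
Lemma laplacian_form h :
  (vertex_row h *m laplacian R e *m (vertex_row h)^T) 0 0 *+ 2
    = \sum_x \sum_y (e x y)%:R * (h x - h y) ^+ 2.
Proof.
have -> : (vertex_row h *m laplacian R e *m (vertex_row h)^T) 0 0
    = \sum_y \sum_x (e x y)%:R * (h y - h x) * h y.
  rewrite mxE -sum_enum_val; apply: eq_bigr => i _.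
  rewrite -{1}(enum_valK i) laplacian_apply !mxE mulr_suml.
  by [].
rewrite mulr2n {1}exchange_big /= -big_split /=; apply: eq_bigr => x _.
rewrite -big_split /=; apply: eq_bigr => y _.
by rewrite [e y x]esym; ring.
Qed.

Lemma laplacian_const : vertex_row (fun=> 1) *m laplacian R e = 0.
Proof.
apply/rowP => i; rewrite -(enum_valK i) laplacian_apply mxE.
by rewrite big1 // => x _; rewrite subrr mulr0.
Qed.

(** Compare the function equal to 1 on [X] and [Y] with the one equal to 1 on
    [X] and -1 on [Y], both 0 elsewhere and then shifted to be orthogonal to the
    constants. As no edge joins [X] to [Y], they have the same Laplacian energy,
    which is at most [mu_n] times the squared norm of the first and at least
    [mu_2] times that of the second. Up to a common
    factor, these squared norms are the coefficients of [mu_n] and [mu_2]. *)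
Lemma separation_inequality (mu : seq R) (X Y : {set T}) (s : R) :
    is_spectrum (laplacian R e) mu -> 0 < mu`_1 -> (0 < #|T|)%N ->
    [disjoint X & Y] -> (forall x y, x \in X -> y \in Y -> ~~ e x y) ->
    #|T|%:R = s + #|X|%:R + #|Y|%:R ->
  mu`_1 * (s * (#|X|%:R + #|Y|%:R) + 4 * #|X|%:R * #|Y|%:R)
    <= mu`_#|T|.-1 * (s * (#|X|%:R + #|Y|%:R)).
Proof.
move=> spec mu1 T0 XY noedge cardT.
have Lsym := laplacian_sym R esym.
pose n : R := #|T|%:R; pose x : R := #|X|%:R; pose y : R := #|Y|%:R.
have n0 : 0 < n by rewrite ltr0n.
(* Scaling by n avoids dividing by it when subtracting the mean. *)
pose p v : R := n * ((v \in X)%:R + (v \in Y)%:R) - (x + y).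
pose q v : R := n * ((v \in X)%:R - (v \in Y)%:R) - (x - y).
have XYv v : ~~ ((v \in X) && (v \in Y)).
  by apply/andP => -[vX]; rewrite (disjointFr XY vX).
have sumX : \sum_v (v \in X)%:R = x.
  by rewrite /x -sum1_card natr_sum [RHS]big_mkcond; apply: eq_bigr => v _; case: ifP.
have sumY : \sum_v (v \in Y)%:R = y.
  by rewrite /y -sum1_card natr_sum [RHS]big_mkcond; apply: eq_bigr => v _; case: ifP.
have sum_cst (c : R) : \sum_(v : T) c = n * c.
  by rewrite sumr_const -[#|_|]/#|T| -mulr_natl.
have normp : \sum_v p v * p v = n * (s * (x + y)).
  transitivity (\sum_v ((n ^+ 2 - 2 * n * (x + y)) * (v \in X)%:R
                  + (n ^+ 2 - 2 * n * (x + y)) * (v \in Y)%:R + (x + y) ^+ 2)).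
    apply: eq_bigr => v _; rewrite /p.
    by case: (v \in X) (v \in Y) (XYv v) => [] [] //= _; ring.
  rewrite !big_split /= -!mulr_sumr sumX sumY sum_cst.
  by rewrite /n cardT -/x -/y; ring.
have normq : \sum_v q v * q v = n * (s * (x + y) + 4 * x * y).
  transitivity (\sum_v ((n ^+ 2 - 2 * n * (x - y)) * (v \in X)%:R
                  + (n ^+ 2 + 2 * n * (x - y)) * (v \in Y)%:R + (x - y) ^+ 2)).
    apply: eq_bigr => v _; rewrite /q.
    by case: (v \in X) (v \in Y) (XYv v) => [] [] //= _; ring.
  rewrite !big_split /= -!mulr_sumr sumX sumY sum_cst.
  by rewrite /n cardT -/x -/y; ring.
have sumq : \sum_v q v * 1 = 0.
  transitivity (\sum_v (n * (v \in X)%:R + - n * (v \in Y)%:R + (y - x))).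
    by apply: eq_bigr => v _; rewrite /q; ring.
  by rewrite !big_split /= -!mulr_sumr sumX sumY !sum_cst; ring.
have one0 : vertex_row (fun=> 1) != 0.
  apply/eqP => /(congr1 (fun r => (r *m (vertex_row (fun=> 1))^T) 0 0)).
  rewrite mul0mx vertex_row_dot sum_cst !mxE mulr1 mulr1.
  by move/eqP; rewrite gt_eqF.
have ge2 := rayleigh_ge_second Lsym spec (u := vertex_row q) one0 laplacian_const mu1.
have lemax := rayleigh_le_max Lsym spec (vertex_row p).
rewrite !vertex_row_dot sumq normq normp in ge2 lemax.
have pq : (vertex_row p *m laplacian R e *m (vertex_row p)^T) 0 0
        = (vertex_row q *m laplacian R e *m (vertex_row q)^T) 0 0.
  apply: (@pmulrnI _ 2) => //=; rewrite !laplacian_form.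
  apply: eq_bigr => u _; apply: eq_bigr => v _; rewrite /p /q.
  have [euv|_] := boolP (e u v); last by rewrite !mul0r.
  have uXvY : ~~ ((u \in X) && (v \in Y)).
    by apply: contraL euv => /andP[uX vY]; exact: noedge.
  have vXuY : ~~ ((v \in X) && (u \in Y)).
    by apply: contraL euv => /andP[vX uY]; rewrite esym; exact: noedge.
  move: (XYv u) (XYv v) uXvY vXuY.
  by case: (u \in X) (u \in Y) (v \in X) (v \in Y) => [] [] [] [] //= _ _ _ _; ring.
have := le_trans (ge2 erefl) _; rewrite -pq => /(_ _ lemax).
by rewrite mulrCA [X in _ <= X]mulrCA ler_pM2l.
Qed.
End LaplacianForm.

(** * From the separation to the matching number *)

(** The ratio of [s * N] to [s * N + (N ^+ 2 - u ^+ 2)] is the largest value of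
    [mu_2 / mu_n] that the separation inequality allows for two groups whose
    sizes have sum [N] and differ by at most [u]; it is bounded here by
    [(2 s + u - 1) / (2 (N + s - 1))]. *)
Lemma barrier_inequality (F : realFieldType) (s N u : F) :
    0 <= s -> 1 <= u -> u + s <= N ->
  2 * (s * N) * (N + s - 1) <= (2 * s + u - 1) * (s * N + (N ^+ 2 - u ^+ 2)).
Proof.
move=> s0 u1 uN; rewrite -subr_ge0.
have -> : (2 * s + u - 1) * (s * N + (N ^+ 2 - u ^+ 2)) - 2 * (s * N) * (N + s - 1)
    = s * (u * (2 * N - u - 1)) + (u - 1) * ((N + u) * (N - u - s)) by ring.
by apply: addr_ge0; do ![apply: mulr_ge0]; lra.
Qed.

(** With [N = x + y] fixed, the halving of the [c] components bounds the
    imbalance by [`|x - y| <= u] where [u = N - c + 1], so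
    [4 x y >= N ^+ 2 - u ^+ 2] and the claim reduces to [barrier_inequality].
    Having [n - 1] rather than [n] in the conclusion matters when [N = c] is odd,
    that is for components reduced to single vertices: then [x] and [y] may
    differ by 1, and the bound with [n] would not follow. *)
Lemma matching_bound_of_ratio (R : realFieldType) (r : R) (s x y c : nat) :
    0 < r -> (s + 2 <= c)%N -> (c./2 <= x)%N -> (uphalf c <= y)%N ->
    r * (s%:R * (x%:R + y%:R) + 4 * x%:R * y%:R) <= s%:R * (x%:R + y%:R) ->
  2 * (r * ((s + x + y)%:R - 1)) <= (s + x + y)%:R + s%:R - c%:R.
Proof.
move=> r0 sc cx cy.
have xle : x%:R + c%:R <= y%:R + (x%:R + y%:R) + 1 :> R.
  have : (x + c <= y + (x + y) + 1)%N by lia.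
  by rewrite -(ler_nat R) !natrD.
have yle : y%:R + c%:R <= x%:R + (x%:R + y%:R) + 1 :> R.
  have : (y + c <= x + (x + y) + 1)%N by lia.
  by rewrite -(ler_nat R) !natrD.
have leN : c%:R <= x%:R + y%:R :> R by rewrite -natrD ler_nat; lia.
have lec : s%:R + 2 <= c%:R :> R by rewrite -natrD ler_nat.
have s0 : 0 <= s%:R :> R by rewrite ler0n.
rewrite !natrD.
move: (s%:R) (x%:R) (y%:R) (c%:R) xle yle leN lec s0 => {sc cx cy}.
move=> {}s {}x {}y {}c xle yle leN lec s0 ratio; set N := x + y; pose u := N - c + 1.
have u1 : 1 <= u by rewrite /u /N; lra.
have uN : u + s + 1 <= N by rewrite /u /N; lra.
pose Q := s * N + (N ^+ 2 - u ^+ 2).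
have Q0 : 0 < Q.
  apply: ltr_wpDl; first by apply: mulr_ge0 => //; lra.
  by rewrite subr_sqr; apply: mulr_gt0; lra.
have leQ : Q <= s * N + 4 * x * y.
  rewrite lerD2l.
  have : (x - y) ^+ 2 <= u ^+ 2.
    rewrite -subr_ge0 subr_sqr; apply: mulr_ge0; rewrite /u /N; lra.
  by rewrite /N; lra.
have rQ : r * Q <= s * N by apply: le_trans ratio; rewrite ler_pM2l.
rewrite -(ler_pM2r Q0).
have key : 2 * (s * N) * (N + s - 1) <= (2 * s + u - 1) * Q.
  by apply: barrier_inequality => //; lra.
have E : s + x + y + s - c = 2 * s + u - 1 by rewrite /u /N; ring.
rewrite E; apply: le_trans key.
have -> : 2 * (r * (s + x + y - 1)) * Q = 2 * (r * Q) * (N + s - 1) by rewrite /N; ring.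
by apply: ler_wpM2r; [lra | rewrite ler_pM2l].
Qed.

Theorem corollary1p4 (R : realType) (T : finType) (e : rel T)
    (esym : symmetric e) (eirr : irreflexive e)
    (edge : exists x y : T, e x y)
    (mu : seq R) (spec_mu : is_spectrum (laplacian R e) mu) :
  let n := #|T| in
  let mu_2 := mu`_1 in
  let mu_n := mu`_n.-1 in
  (matching_number e)%:Z >=
    Num.min (Num.ceil (mu_2 / mu_n * (n%:R - 1)))
            (Num.ceil (2^-1 * (n%:R - 1) : R)).
Proof.
cbv zeta; set n := #|T|; set mu_2 := mu`_1; set mu_n := mu`_n.-1.
rewrite ge_min !ceil_le_int -pmulrn.
have n_gt0 : (0 < n)%N by case: edge => x _; apply/card_gt0P; exists x.
have n_ge1 : 0 <= n%:R - 1 :> R by rewrite subr_ge0 ler1n.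
have mun_ge0 : 0 <= mu_n.
  have := rayleigh_le_max (laplacian_sym R esym) spec_mu (vertex_row (fun=> 1)).
  rewrite (laplacian_const _ esym) mul0mx mxE vertex_row_dot mulr1 sumr_const.
  by rewrite pmulr_lge0 // ltr0n.
have [ratio_le0|ratio_gt0] := lerP (mu_2 / mu_n) 0.
  by rewrite (le_trans (mulr_le0_ge0 ratio_le0 n_ge1)).
have mun_gt0 : 0 < mu_n.
  rewrite lt_def mun_ge0 andbT; apply: contraTneq ratio_gt0 => ->.
  by rewrite invr0 mulr0 ltxx.
have mu2_gt0 : 0 < mu_2 by rewrite -(divfK (lt0r_neq0 mun_gt0) mu_2) mulr_gt0.
have [S [U [X [Y [leM [leX leY] cardT XY noedge]]]]] := balanced_separation esym eirr.
have leMR : n%:R + #|S|%:R <= 2 * (matching_number e)%:R + #|U|%:R :> R.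
  by move: leM; rewrite -(ler_nat R) !natrD -mul2n natrM.
(* With |U| <= |S| + 1 a maximum matching misses at most one vertex. *)
have [few|many] := leqP #|U| #|S|.+1.
  by apply/orP; right; move: few; rewrite -(ler_nat R) -natr1; lra.
apply/orP; left.
have cardTR : #|T|%:R = #|S|%:R + #|X|%:R + #|Y|%:R :> R by rewrite cardT !natrD.
have sep := separation_inequality esym spec_mu mu2_gt0 n_gt0 XY noedge cardTR.
have ratio : mu_2 / mu_n * (#|S|%:R * (#|X|%:R + #|Y|%:R) + 4 * #|X|%:R * #|Y|%:R)
    <= #|S|%:R * (#|X|%:R + #|Y|%:R)
  by rewrite mulrAC ler_pdivrMr // [leRHS]mulrC.
have := matching_bound_of_ratio ratio_gt0 _ leX leY ratio.
rewrite addn2 -cardT -/n => /(_ many); lra.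
Qed.
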